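(* (1) In the affine group over a finite nonzero vector space, an abelian regular subgroup intersects the group of translations nontrivially. That is, if $V$ is a finite nonzero vector space over a field, $N$ is the group of translations of $V$, and $T$ is an abelian regular subgroup of $\mathrm{Aff}(V)$, then $N \cap T \neq \{1\}$. (2) There is an example, due to Pál Hegedűs, of a nonabelian regular subgroup of an affine group over a finite vector space which has trivial intersection with the group of translations. (3) There is an example of an abelian regular subgroup of the affine group over an infinite-dimensional vector space which has trivial intersection with the group of translations. Namely, let $F$ be an arbitrary field, and let $V = tF[[t]]$ be the maximal ideal of the $F$-algebra $F[[t]]$ of formal power series over $F$, regarded as a vector space over $F$. For $x \in V$ let $\tau(x) : V \to V$ be the map $z \mapsto z + x + zx$, and let $T = \{\tau(x) : x \in V\}$. Then $T$ is an abelian regular subgroup of $\mathrm{Aff}(V)$, and $N \cap T = \{1\}$, where $N$ is the group of translations of $V$.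
   Context: For a vector space $V$ over a field $F$, the group of translations is $N = \{\nu(x) : x \in V\}$, where $\nu(x) : z \mapsto z + x$, and $\mathrm{Aff}(V)$ is the affine group on $V$: the group of permutations of $V$ generated by $N$ and the group $\mathrm{GL}(V)$ of invertible $F$-linear maps on $V$. A group $G$ of permutations on a set $\Omega$ is regular if, given any $\alpha \in \Omega$, for each $\beta \in \Omega$ there exists a unique $g \in G$ mapping $\alpha$ to $\beta$. *)

(* Defs.v *)
From HB Require Import structures.
From mathcomp Require Import all_boot all_order all_algebra all_classical.

Set Implicit Arguments.
Unset Strict Implicit.
Unset Printing Implicit Defensive.

Import GRing.Theory.
Local Open Scope classical_set_scope.
Local Open Scope ring_scope.

(* Permutations of a possibly infinite set are bijective functions, with    *)
(* composition as product and [id] as neutral element; a group of           *)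
(* permutations is a set of functions.                                      *)
Section PermutationGroups.
Variable Omega : Type.
Implicit Types (G H S : set (Omega -> Omega)).

Definition perm_group G : Prop :=
  [/\ G `<=` [set f | bijective f],
      G id,
      forall f g, G f -> G g -> G (f \o g) &
      forall f g, G f -> cancel f g -> cancel g f -> G g].

(* Meaningful when [S] consists of permutations: otherwise the family being *)
(* intersected is empty and the result is the set of all functions.         *)
Definition perm_group_gen S : set (Omega -> Omega) :=
  [set f | forall G, perm_group G -> S `<=` G -> G f].

Definition perm_subgroup H G : Prop := perm_group H /\ H `<=` G.

Definition abelian_perm G : Prop :=
  forall f g, G f -> G g -> f \o g = g \o f.

Definition regular_perm G : Prop :=
  forall alpha beta : Omega, exists! g, G g /\ g alpha = beta.

End PermutationGroups.

Section AffineGroup.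
Variables (F : fieldType) (V : lmodType F).

Definition translation (x : V) : V -> V := fun z => z + x.

Definition translations : set (V -> V) := range translation.

Definition general_linear : set (V -> V) :=
  [set f | linear f /\ bijective f].

Definition affine_group : set (V -> V) :=
  perm_group_gen (translations `|` general_linear).

Definition finite_dimensional : Prop :=
  exists (n : nat) (e : 'I_n -> V),
    forall v : V, exists c : 'I_n -> F, v = \sum_(i < n) c i *: e i.

End AffineGroup.

Arguments translations {F} V.
Arguments general_linear {F} V.
Arguments affine_group {F} V.
Arguments finite_dimensional {F} V.

(* The algebra F[[t]]. The sequence of coefficients is wrapped in a record  *)
(* because [nat -> F] already carries the pointwise product.                *)
Record fps (F : Type) := Fps { fps_coef : nat -> F }.

HB.instance Definition _ (F : Type) := [isNew for @fps_coef F].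
HB.instance Definition _ (F : choiceType) := [Equality of fps F by <:].
HB.instance Definition _ (F : choiceType) := [Choice of fps F by <:].

Section PowerSeries.
Variable F : fieldType.
Implicit Types f g h : fps F.

Definition fps_zero : fps F := Fps (fun _ => 0).
Definition fps_opp f : fps F := Fps (fun n => - fps_coef f n).
Definition fps_add f g : fps F := Fps (fun n => fps_coef f n + fps_coef g n).
Definition fps_scale (a : F) f : fps F := Fps (fun n => a * fps_coef f n).
Definition fps_one : fps F := Fps (fun n => (n == 0%N)%:R).
Definition fps_mul f g : fps F :=
  Fps (fun n => \sum_(i < n.+1) fps_coef f i * fps_coef g (n - i)%N).

Lemma fpsP f g : fps_coef f =1 fps_coef g <-> f = g.
Proof.
split=> [fg|-> //]; case: f g fg => [f] [g] /= fg.
by congr Fps; apply/funext.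
Qed.

Fact fps_addA : associative fps_add.
Proof. by move=> f g h; apply/fpsP => n /=; rewrite addrA. Qed.
Fact fps_addC : commutative fps_add.
Proof. by move=> f g; apply/fpsP => n /=; rewrite addrC. Qed.
Fact fps_add0 : left_id fps_zero fps_add.
Proof. by move=> f; apply/fpsP => n /=; rewrite add0r. Qed.
Fact fps_addN : left_inverse fps_zero fps_opp fps_add.
Proof. by move=> f; apply/fpsP => n /=; rewrite addNr. Qed.

HB.instance Definition _ :=
  GRing.isZmodule.Build (fps F) fps_addA fps_addC fps_add0 fps_addN.

Fact fps_scaleA a b f : fps_scale a (fps_scale b f) = fps_scale (a * b) f.
Proof. by apply/fpsP => n /=; rewrite mulrA. Qed.
Fact fps_scale1 : left_id 1 fps_scale.
Proof. by move=> f; apply/fpsP => n /=; rewrite mul1r. Qed.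
Fact fps_scaleDr : right_distributive fps_scale +%R.
Proof. by move=> a f g; apply/fpsP => n /=; rewrite mulrDr. Qed.
Fact fps_scaleDl f : {morph fps_scale^~ f : a b / a + b}.
Proof. by move=> a b; apply/fpsP => n /=; rewrite mulrDl. Qed.

HB.instance Definition _ := GRing.Zmodule_isLmodule.Build F (fps F)
  fps_scaleA fps_scale1 fps_scaleDr fps_scaleDl.

Let trunc n f : {poly F} := \poly_(i < n) fps_coef f i.

Let coef_trunc n f i : (i < n)%N -> (trunc n f)`_i = fps_coef f i.
Proof. by move=> lt_in; rewrite coef_poly lt_in. Qed.

Let coef_mul_trunc n f g i : (i < n)%N ->
  fps_coef (fps_mul f g) i = (trunc n f * trunc n g)`_i.
Proof.
move=> lt_in; rewrite coefM; apply: eq_bigr => j _.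
rewrite !coef_trunc //; first exact: leq_ltn_trans (leq_subr _ _) lt_in.
by apply: leq_ltn_trans lt_in; rewrite -ltnS.
Qed.

Fact fps_mulA : associative fps_mul.
Proof.
move=> f g h; apply/fpsP => n.
transitivity (trunc n.+1 f * (trunc n.+1 g * trunc n.+1 h))`_n.
  rewrite coefM; apply: eq_bigr => i _.
  by rewrite coef_trunc // -coef_mul_trunc // ltnS leq_subr.
rewrite mulrA coefM; apply: eq_bigr => i _.
by rewrite -coef_mul_trunc // coef_trunc // ltnS leq_subr.
Qed.
Fact fps_mulC : commutative fps_mul.
Proof.
by move=> f g; apply/fpsP => n; rewrite !(@coef_mul_trunc n.+1) // mulrC.
Qed.
Fact fps_mul1 : left_id fps_one fps_mul.
Proof.
move=> f; apply/fpsP => n /=.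
by rewrite big_ord_recl /= mul1r subn0 big1 ?addr0 // => i _; rewrite mul0r.
Qed.
Fact fps_mulDl : left_distributive fps_mul +%R.
Proof.
move=> f g h; apply/fpsP => n /=; rewrite -big_split /=.
by apply: eq_bigr => i _; rewrite mulrDl.
Qed.
Fact fps_one_neq0 : fps_one != 0.
Proof.
by apply/eqP => /fpsP/(_ 0%N)/= /eqP; rewrite (oner_eq0 F).
Qed.

HB.instance Definition _ := GRing.Zmodule_isComNzRing.Build (fps F)
  fps_mulA fps_mulC fps_mul1 fps_mulDl fps_one_neq0.

Fact fps_scaleAl (a : F) f g : a *: (f * g) = (a *: f) * g.
Proof.
apply/fpsP => n /=; rewrite mulr_sumr.
by apply: eq_bigr => i _; rewrite mulrA.
Qed.

HB.instance Definition _ := GRing.Lmodule_isLalgebra.Build F (fps F)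
  fps_scaleAl.
HB.instance Definition _ := GRing.Lalgebra_isComAlgebra.Build F (fps F).

Definition fpsX : fps F := Fps (fun n => (n == 1%N)%:R).

Definition fpsX_ideal : {pred fps F} :=
  fun f => `[< exists g, f = fpsX * g >].

Lemma fpsX_idealP f : reflect (exists g, f = fpsX * g) (f \in fpsX_ideal).
Proof. exact: asboolP. Qed.

Lemma mem_fpsX_ideal f : (f \in fpsX_ideal) = (fps_coef f 0 == 0).
Proof.
apply/fpsX_idealP/eqP => [[g ->]|f0].
  by rewrite /= big_ord1 /= mul0r.
exists (Fps (fun n => fps_coef f n.+1)); apply/fpsP => -[|n] /=.
  by rewrite big_ord1 /= mul0r.
rewrite big_ord_recl big_ord_recl /= mul0r add0r mul1r.
by rewrite big1 ?addr0 ?subSS ?subn0 // => i _; rewrite mul0r.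
Qed.

Fact fpsX_ideal_submod_closed : submod_closed fpsX_ideal.
Proof.
split=> [|a f g]; rewrite !mem_fpsX_ideal //= => /eqP f0 /eqP g0.
by rewrite f0 g0 mulr0 addr0.
Qed.
HB.instance Definition _ :=
  GRing.isSubmodClosed.Build F (fps F) fpsX_ideal fpsX_ideal_submod_closed.

Lemma fpsX_idealM f g : g \in fpsX_ideal -> f * g \in fpsX_ideal.
Proof.
by case/fpsX_idealP => h ->; apply/fpsX_idealP; exists (f * h); rewrite mulrCA.
Qed.

(* The ideal tF[[t]] as a type, so that it is itself a vector space over F. *)
Record tfps := TFps { tfps_val :> fps F; tfps_valP : tfps_val \in fpsX_ideal }.

HB.instance Definition _ := [isSub for tfps_val].
HB.instance Definition _ := [Choice of tfps by <:].
HB.instance Definition _ := [SubChoice_isSubLmodule of tfps by <:].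

Definition tfps_mul (z x : tfps) : tfps :=
  TFps (fpsX_idealM (tfps_val z) (tfps_valP x)).

Definition tau (x : tfps) : tfps -> tfps := fun z => z + x + tfps_mul z x.

End PowerSeries.

(* Main.v *)
Require Import Defs.
From mathcomp Require Import all_boot all_order all_algebra all_classical.
From mathcomp Require Import finmap.

(** The affine group of V is the set of bijections f for which f - f 0 is
linear ([affine_groupP]); everything else is read off from this description.

Finite abelian case.  Let T be abelian and regular, and let tau x be the
element of T sending 0 to x.  Put x * z = tau x z - x - z.  Commutativity of T
makes the product commutative, affinity makes it biadditive, and closure of T
under composition makes it associative: V becomes a commutative ring in which
tau x z = x + z + x * z.  If x * z = z then tau (- x) sends z and 0 to the same
point, so z = 0.  Thus a nonzero z never lies in V * z, and the additive
subgroup V * (x * y) is strictly smaller than V * y whenever x * y is nonzero.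
As V is finite, this descent stops at some y <> 0 with V * y = 0
([finite_radical_annihilator]), and then tau y is the translation by y.

Finite nonabelian example.  Let q be a quadratic form on W whose polar form
has no radical, and let the additive group of F act faithfully on W by
isometries of q.  The semidirect product of W and F then acts on itself by left
translations.  The change of coordinates (w, c) |-> (w, q w + c) makes these
maps affine on W x F: the defect of linearity is the failure of additivity of
q, which is the polar form, linear in one variable.  A translation among them
would have trivial linear part, so it would lie in the kernel of the action and
in the radical of the polar form ([hegedus_law_regular]).  The hyperbolic plane
over F_2, with the swap of its two coordinates, gives a dihedral group of order
8 acting on F_2^3.

Power series.  The map z |-> 1 + z turns tau x into multiplication by 1 + x.
So T is the group of series with constant term 1 acting on itself by
multiplication; these series have inverses (geometric series) of the same
kind.  If tau x is a translation then z x = 0 for all z, and z = t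
gives x = 0. *)

Set Implicit Arguments.
Unset Strict Implicit.
Unset Printing Implicit Defensive.

Import GRing.Theory.
Local Open Scope classical_set_scope.
Local Open Scope ring_scope.

(** * The affine group *)

Section Affine.
Variables (F : fieldType) (V : lmodType F).
Implicit Types (f g : V -> V) (x : V).

(** Linearity of f - f 0, with the constant term moved to one side so that it
rewrites f itself. *)
Definition affine_map f : Prop :=
  forall a u v, f (a *: u + v) = a *: (f u - f 0) + f v.

Lemma affine_map_linear f : affine_map f <-> linear (fun z => f z - f 0).
Proof.
split=> fP a u v; first by rewrite fP addrA.
by have /= := fP a u v; rewrite addrA => /addIr.
Qed.

Lemma affine_mapD f u v : affine_map f -> f (u + v) = f u + f v - f 0.
Proof. by move=> /(_ 1 u v); rewrite !scale1r addrAC. Qed.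

Lemma affine_mapB f u v : affine_map f -> f (u - v) = f u - f v + f 0.
Proof.
move=> af; have := affine_mapD (u - v) v af; rewrite subrK => ->.
by rewrite addrAC subrK addrK.
Qed.

Lemma affine_bij_group : perm_group [set f | bijective f /\ affine_map f].
Proof.
split=> [f [] // | | f g [bf af] [bg ag] | f g [bf af] fK gK].
- by split=> [|a u v]; [exists id | rewrite subr0].
- split=> [|a u v /=]; first exact: bij_comp.
  by rewrite ag af (affine_mapB _ _ af) addrK.
- split=> [|a u v]; first by exists f.
  by apply: (can_inj fK); rewrite gK af (affine_mapB _ _ af) addrK !gK subr0.
Qed.

(** An affine bijection f is the linear bijection f - f 0 followed by the
translation by f 0; conversely affine bijections form a group containing the
generators. *)
Lemma affine_groupP f : affine_group V f <-> bijective f /\ affine_map f.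
Proof.
split=> [fP | [bf af] G [_ _ GM _] sub].
  apply: (fP _ affine_bij_group).
  move=> g [[x _ <-]|[lg bg]].
    split=> [|a u v]; last by rewrite /translation add0r addrK addrA.
    by exists (translation (- x)) => z; rewrite /translation (addrK, subrK).
  split=> // a u v.
  have g0 : g 0 = 0 by have := lg (-1) 0 0; rewrite scaler0 add0r scaleN1r addNr.
  by rewrite g0 subr0 lg.
pose l z := f z - f 0.
have -> : f = translation (f 0) \o l.
  by apply/funext => z /=; rewrite /translation subrK.
apply: GM; apply: sub; [by left; exists (f 0) | right; split].
  exact/affine_map_linear.
case: bf => g fK gK; exists (fun z => g (z + f 0)) => z; rewrite /l.
  by rewrite subrK fK.
by rewrite gK addrK.
Qed.
End Affine.

(** * Regular groups of left translations *)

Section LeftTranslations.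
Variables (T : Type) (e : T) (phi : T -> T -> T).
Hypothesis phi1 : forall z, phi e z = z.
Hypothesis phie : forall x, phi x e = x.
Hypothesis phiM : forall x y z, phi (phi x y) z = phi x (phi y z).
Hypothesis phiV : forall x, exists y, phi y x = e.

(** Left inverses in a monoid are two-sided, since the left inverse of a left
inverse of x is x itself. *)
Lemma left_translation_inv x :
  exists y, cancel (phi x) (phi y) /\ cancel (phi y) (phi x).
Proof.
have [y yx] := phiV x; have [z zy] := phiV y.
have zx : z = x by rewrite -[x]phi1 -zy phiM yx phie.
by rewrite zx in zy; exists y; split=> w; rewrite -phiM ?yx ?zy phi1.
Qed.

Lemma left_translations_group : perm_group (range phi).
Proof.
split=> [_ [x _ <-] | | _ _ [x _ <-] [y _ <-] | _ g [x _ <-] xg gx].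
- by have [y [xy yx]] := left_translation_inv x; exists (phi y).
- by exists e => //; apply/funext.
- by exists (phi x y) => //; apply/funext => z; rewrite phiM.
- have [y [xy yx]] := left_translation_inv x.
  by exists y => //; apply/funext => z; rewrite -[z in LHS]gx xy.
Qed.

(** The group acts on itself simply transitively: the element sending a to b
is b a^-1. *)
Lemma left_translations_regular : regular_perm (range phi).
Proof.
move=> a b; have [a' [aK a'K]] := left_translation_inv a.
have aa' : phi a' a = e by have := aK e; rewrite phie.
exists (phi (phi b a')); split.
  by split; [exists (phi b a') | rewrite phiM aa' phie].
move=> _ [[x _ <-] <-]; apply/funext => z.
by rewrite !phiM a'K.
Qed.
End LeftTranslations.

(** When the neutral element of the law is the zero vector, the left
translation by x sends 0 to x, so the only translation it can be is
[translation x]. *)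
Section AffineLaw.
Variables (F : fieldType) (V : lmodType F) (phi : V -> V -> V).
Hypothesis phi1 : forall z, phi 0 z = z.
Hypothesis phi0 : forall x, phi x 0 = x.
Hypothesis phiM : forall x y z, phi (phi x y) z = phi x (phi y z).
Hypothesis phiV : forall x, exists y, phi y x = 0.
Hypothesis phi_affine : forall x, affine_map (phi x).

Lemma left_translations_affine :
  perm_subgroup (range phi) (affine_group V).
Proof.
have gP := left_translations_group phi1 phi0 phiM phiV.
split=> // _ [x _ <-]; apply/affine_groupP; split=> //.
by case: gP => sub _ _ _; apply: sub; exists x.
Qed.

Lemma translations_left_translations :
  (forall x, (forall z, phi x z = z + x) -> x = 0) ->
  translations V `&` range phi = [set id].
Proof.
move=> triv; apply/seteqP; split=> [_ [[y _ <-] [x _ /funeqP xy]] | _ ->] /=.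
  have yx : y = x by rewrite -[RHS]phi0 xy /translation add0r.
  have x0 : x = 0 by apply: triv => z; rewrite xy yx.
  by apply/funext => z; rewrite /translation yx x0 addr0.
split; first by exists 0 => //; apply/funext => z; exact: addr0.
by exists 0 => //; apply/funext.
Qed.
End AffineLaw.

(** * Abelian regular subgroups over finite spaces *)

Section RadicalProduct.
Variables (V : zmodType) (m : V -> V -> V).
Hypothesis mA : associative m.
Hypothesis m_radical : forall x z, m x z = z -> z = 0.

(** Descent on the cardinality of V * y.  If x * y <> 0 then V * (x * y) is
contained in V * y by associativity, and misses x * y, which lies in V * y. *)
Lemma finite_radical_annihilator :
  finite_set [set: V] -> (exists v : V, v != 0) ->
  exists2 y, y != 0 & forall x, m x y = 0.
Proof.
move=> finV [v v0].
have finI y : finite_set (range (m^~ y)).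
  exact: sub_finite_set (@subsetT _ _) finV.
pose size_ideal y := #|` fset_set (range (m^~ y))|%fset.
have [n] := ubnP (size_ideal v); elim: n v v0 => // n IHn y y0 ley.
have [ann|/existsNP[x /eqP xy0]] := pselect (forall x, m x y = 0).
  by exists y.
apply: (IHn (m x y)) => //; rewrite -ltnS; apply: leq_trans ley; rewrite ltnS.
apply: fproper_ltn_card; rewrite fproperE; apply/andP; split.
  rewrite -fset_set_sub //.
  by move=> _ [w _ <-]; exists (m w x) => //; rewrite mA.
apply/negP; rewrite -fset_set_sub // => /(_ (m x y)) [|w _ wxy].
  by exists x.
by move/eqP: xy0; apply; apply: m_radical wxy.
Qed.
End RadicalProduct.

Section AbelianRegular.
Variables (F : fieldType) (V : lmodType F) (T : set (V -> V)).
Hypothesis T_affine : perm_subgroup T (affine_group V).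
Hypothesis T_abelian : abelian_perm T.
Hypothesis T_regular : regular_perm T.

(** Regularity parametrizes T by the image of 0, and the composition of T
becomes the law (x, y) |-> tau x y on V. *)
Lemma abelian_regular_law : exists tau : V -> V -> V,
  [/\ forall x, T (tau x), forall x, tau x 0 = x,
      forall x y, tau x y = tau y x,
      forall x y z, tau (tau x y) z = tau x (tau y z) &
      forall x, injective (tau x) /\ affine_map (tau x)].
Proof.
have [[_ _ TM _] Taff] := T_affine.
have [tau tauP] : {tau : V -> V -> V & forall x, T (tau x) /\ tau x 0 = x}.
  apply: (choice (P := fun x f => T f /\ f 0 = x)) => x.
  by have [f [fP _]] := T_regular 0 x; exists f.
have tauT x : T (tau x) by case: (tauP x).
have tau0 x : tau x 0 = x by case: (tauP x).
have tauC x y : tau x y = tau y x.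
  have /funeqP/(_ 0) /= := T_abelian (tauT x) (tauT y).
  by rewrite !tau0.
exists tau; split=> // [x y z | x].
  have [f [_ f_uniq]] := T_regular 0 (tau x y).
  suff /funeqP/(_ z) : tau (tau x y) = tau x \o tau y by [].
  rewrite -(f_uniq (tau (tau x y))) //; apply: f_uniq.
  split; last by rewrite /= tau0.
  exact: TM.
have /affine_groupP[bx ax] := Taff _ (tauT x).
by split=> //; exact: bij_inj.
Qed.

(** The product x * z = tau x z - (x + z) makes V a commutative radical ring,
and tau y is a translation exactly when y annihilates V. *)
Lemma abelian_regular_translation :
  finite_set [set: V] -> (exists v : V, v != 0) ->
  exists2 y, y != 0 & T (translation y).
Proof.
have [tau [tauT tau0 tauC tauM tauP]] := abelian_regular_law.
pose m x z := tau x z - (x + z).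
have tauE x z : tau x z = m x z + (x + z) by rewrite subrK.
have mC : commutative m by move=> x z; rewrite /m tauC [x + z]addrC.
have mDr x y z : m x (y + z) = m x y + m x z.
  rewrite /m (affine_mapD _ _ (f := tau x)) ?tau0; last by case: (tauP x).
  by rewrite !opprD !addrA [LHS](ACl (1*3*5*2*4*6)).
have mz0 x : m x 0 = 0 by rewrite /m tau0 addr0 subrr.
clearbody m.
have mDl x y z : m (x + y) z = m x z + m y z by rewrite ![m _ z]mC mDr.
(* Both sides of tauM expand to the same sum, except for the triple product. *)
have mA : associative m.
  move=> x y z; have := tauM x y z.
  rewrite !tauE !mDl !mDr !addrA [RHS](ACl (1*3*5*2*4*6*7)) /=.
  by do 6!move/addIr.
(* If x * z = z then tau (- x) z = - x + z - z = tau (- x) 0. *)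
have m_radical x z : m x z = z -> z = 0.
  move=> xz; have [inj _] := tauP (- x); apply: inj.
  rewrite tau0 tauE.
  have -> : m (- x) z = - z.
    by apply/eqP; rewrite -addr_eq0 -{2}xz -mDl addNr mC mz0.
  by rewrite addrCA addNr addr0.
move=> finV V0.
have [y y0 ann] := finite_radical_annihilator mA m_radical finV V0.
exists y => //; rewrite (_ : translation y = tau y) //.
by apply/funext => z; rewrite tauE mC ann add0r addrC.
Qed.
End AbelianRegular.

(** * A nonabelian regular subgroup without translations *)

Section Orthogonal.
Variables (F : fieldType) (W : lmodType F) (q : W -> F) (act : F -> W -> W).
Let polar v w := q (v + w) - q v - q w.
Hypothesis polar_scalar : forall w, scalar (polar^~ w).
Hypothesis polar_nondegenerate : forall w, (forall v, polar v w = 0) -> w = 0.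
Hypothesis act_linear : forall c, linear (act c).
Hypothesis act_id : forall v, act 0 v = v.
Hypothesis actD : forall c d v, act (c + d) v = act c (act d v).
Hypothesis act_q : forall c v, q (act c v) = q v.
Hypothesis act_faithful : forall c, (forall v, act c v = v) -> c = 0.

Let V : lmodType F := (W * F^o)%type.

(** The coordinate c of (w, q w + c): it says through which isometry a vector
of W x F acts. *)
Definition param (x : V) : F := x.2 - q x.1.

(** The semidirect product law (w, c) (v, d) = (act c v + w, c + d), transported
along (w, c) |-> (w, q w + c). *)
Definition hegedus_law (x z : V) : V :=
  let w := act (param x) z.1 + x.1 in (w, q w + (param x + param z)).

Let law_fst x z : (hegedus_law x z).1 = act (param x) z.1 + x.1.
Proof. by []. Qed.

Let paramM x z : param (hegedus_law x z) = param x + param z.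
Proof. by rewrite /param /= addrC addKr. Qed.

Let param_eq (x z : V) : x.1 = z.1 -> param x = param z -> x = z.
Proof. by case: x z => [w a] [v b] /= ->; rewrite /param /= => /addIr ->. Qed.

Let act0 c : act c 0 = 0.
Proof. by have := act_linear c (-1) 0 0; rewrite scaler0 add0r scaleN1r addNr. Qed.

Let actB c v w : act c (v + w) = act c v + act c w.
Proof. by have := act_linear c 1 v w; rewrite !scale1r. Qed.

Let q0 : q 0 = 0.
Proof.
have := polar_scalar 0 (-1) 0 0; rewrite scaler0 addr0 /polar !addr0 subrr sub0r.
by rewrite mulN1r opprK subrr => /eqP; rewrite oppr_eq0 => /eqP.
Qed.

Let param0 : param 0 = 0.
Proof. by rewrite /param /= q0 subrr. Qed.

Let law1 z : hegedus_law 0 z = z.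
Proof.
apply: param_eq; last by rewrite paramM param0 add0r.
by rewrite /= param0 act_id addr0.
Qed.

Let law0 x : hegedus_law x 0 = x.
Proof.
apply: param_eq; last by rewrite paramM param0 addr0.
by rewrite /= act0 add0r.
Qed.

Let lawM x y z :
  hegedus_law (hegedus_law x y) z = hegedus_law x (hegedus_law y z).
Proof.
apply: param_eq; last by rewrite !paramM -addrA.
by rewrite !law_fst paramM actD actB addrA.
Qed.

Let lawV x : exists y, hegedus_law y x = 0.
Proof.
pose w := - act (- param x) x.1.
exists (w, q w - param x); apply: param_eq.
  by rewrite /= [param _]addrAC subrr sub0r subrr.
by rewrite paramM param0 [param (w, _)]addrAC subrr sub0r addNr.
Qed.

(* By invariance of q, the second component of law x z - x is the polar form of
   act (param x) z.1 and x.1, plus z.2. *)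
Let law_affine x : affine_map (hegedus_law x).
Proof.
have lawB z : hegedus_law x z - x =
    (act (param x) z.1, polar (act (param x) z.1) x.1 + z.2) :> V.
  apply/pair_equal_spec; split; rewrite /= ?addrK //.
  rewrite /param /polar act_q.
  by rewrite !addrA [LHS](ACl (1*5*3*4*2*6)) /= addrK.
apply/affine_map_linear => a u v; rewrite law0 !lawB.
apply/pair_equal_spec; split; rewrite /= act_linear //.
by rewrite polar_scalar scalerDr addrACA.
Qed.

(** If the group were abelian, (0, c) and (w, q w) would commute, and this says
that act c fixes w.  If the left translation by x is a translation, then
act (param x) is the identity, so param x = 0 and x = (w, q w); what remains of
the second component is then the polar form with w, which must vanish. *)
Lemma hegedus_law_regular :
  [/\ perm_subgroup (range hegedus_law) (affine_group V),
      ~ abelian_perm (range hegedus_law),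
      regular_perm (range hegedus_law) &
      translations V `&` range hegedus_law = [set id]].
Proof.
split.
- exact: left_translations_affine law1 law0 lawM lawV law_affine.
- move=> ab; have /eqP := oner_neq0 F; apply; apply: act_faithful => v.
  have /funeqP/(_ 0) /= :=
    ab _ _ (imageT hegedus_law (0, 1)) (imageT hegedus_law (v, q v)).
  rewrite !law0 => /(congr1 fst) /=.
  by rewrite act0 add0r addr0 /param /= q0 subr0.
- exact: left_translations_regular law1 law0 lawM lawV.
- apply: translations_left_translations law1 law0 _ => x xP.
  have actx v : act (param x) v = v.
    by have /(congr1 fst)/= /addIr := xP (v, 0).
  have skx : param x = 0 by exact: act_faithful.
  apply: param_eq; rewrite ?param0 //=; apply: polar_nondegenerate => v.
  have /(congr1 snd) /= := xP (v, q v).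
  rewrite actx skx /param /= subrr !addr0 /polar => ->.
  have /eqP := skx; rewrite subr_eq0 => /eqP ->.
  by rewrite [q v + _]addrC addrK subrr.
Qed.
End Orthogonal.

(** The form q (a, b) = a b is invariant under the swap of a and b, and over F_2
the additive group of the field has order 2, like the swap. *)
Section HyperbolicPlane.
Let F : fieldType := 'F_2.
Let W : lmodType F := (F^o * F^o)%type.
Let q (v : W) : F := v.1 * v.2.
Let swap (c : F) (v : W) : W := if c == 0 then v else (v.2, v.1).

Let F2P (c : F) : c = 0 \/ c = 1.
Proof. by case: c => [[|[|n]] ltn2] //; [left | right]; apply: val_inj. Qed.

Let polarE v w : q (v + w) - q v - q w = v.1 * w.2 + w.1 * v.2.
Proof.
rewrite /q /= mulrDl !mulrDr !addrA.
by rewrite [LHS](ACl (2*3*1*5*4*6)) /= addrK addrK.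
Qed.

Lemma hegedus_example :
  exists (F : fieldType) (V : lmodType F) (T : set (V -> V)),
     [/\ finite_set [set: V],
         perm_subgroup T (affine_group V),
         ~ abelian_perm T,
         regular_perm T &
         translations V `&` T = [set id]].
Proof.
have [|||||||sub nab reg triv] := @hegedus_law_regular F W q swap.
- move=> w a u v /=; rewrite !polarE /= mulrDl !mulrDr.
  by rewrite -!mulrA [w.1 * (a * _)]mulrCA addrACA.
- move=> w wP.
  have w1 : w.1 = 0 by have := wP (0, 1); rewrite polarE /= mul0r add0r mulr1.
  have w2 : w.2 = 0 by have := wP (1, 0); rewrite polarE /= mulr0 addr0 mul1r.
  by rewrite [w]surjective_pairing w1 w2.
- by move=> c a u v; rewrite /swap; case: ifP.
- by move=> v; rewrite /swap eqxx.
- move=> c d v; rewrite /swap.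
  case: (F2P c) => ->; case: (F2P d) => ->; rewrite ?add0r ?addr0 ?eqxx //=.
  by case: v.
- by move=> c v; rewrite /swap /q; case: ifP => //= _; rewrite mulrC.
- move=> c; case: (F2P c) => // -> /(_ (1, 0)) [].
  by [].
- exists F, (W * F^o)%type, (range (hegedus_law q swap)); split=> //.
  exact: (@finite_finset ('F_2 * 'F_2 * 'F_2)%type).
Qed.
End HyperbolicPlane.

(** * Power series without constant term *)

Section PowerSeries.
Variable F : fieldType.
Implicit Types (f g : fps F) (x y z : tfps F).

Lemma coef_expr_small f m i :
  f \in @fpsX_ideal F -> (i < m)%N -> fps_coef (f ^+ m) i = 0.
Proof.
rewrite mem_fpsX_ideal => /eqP f0; elim: m i => // m IHm i lt_im.
rewrite exprS /= big1 // => -[[|j] ltj] _; first by rewrite f0 mul0r.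
rewrite IHm ?mulr0 //=.
by rewrite ltn_subLR //; rewrite addSn ltnS; apply: leq_trans (leq_addl _ _).
Qed.

(** The inverse is the geometric series of - f.  Its coefficient of index n is
that of the partial sum S n.+1, because later terms have higher order; and
only coefficients of index at most n enter that of a product. *)
Lemma one_plus_tfps_inv f :
  f \in @fpsX_ideal F -> exists u, u * (1 + f) = 1.
Proof.
move=> fI; pose S m := \sum_(k < m) (- f) ^+ k.
have nfI : - f \in @fpsX_ideal F by rewrite rpredN.
have coefS m i : (i < m)%N -> fps_coef (S m) i = fps_coef (S i.+1) i.
  elim: m => // m IHm; rewrite ltnS leq_eqVlt => /predU1P[-> //|lt_im].
  by rewrite /S big_ord_recr /= coef_expr_small // addr0 IHm.
exists (Fps (fun n => fps_coef (S n.+1) n)); apply/fpsP => n.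
transitivity (fps_coef (S n.+1 * (1 + f)) n).
  apply: eq_bigr => i _ /=; congr (_ * _).
  by rewrite (coefS n.+1).
have -> : S n.+1 * (1 + f) = 1 - (- f) ^+ n.+1.
  by rewrite -opprB subrX1 -mulNr opprB opprK mulrC.
by rewrite /= coef_expr_small // oppr0 addr0.
Qed.

Lemma tau_val x z :
  tfps_val (tau x z) = tfps_val z + tfps_val x + tfps_val z * tfps_val x.
Proof. by []. Qed.

(** This carries the group laws of multiplication over to tau. *)
Lemma one_plus_tau x z :
  1 + tfps_val (tau x z) = (1 + tfps_val z) * (1 + tfps_val x).
Proof.
rewrite tau_val mulrDl mul1r mulrDr mulr1 -!addrA.
by rewrite [in LHS](addrCA (tfps_val z)).
Qed.

Lemma tauC x z : tau x z = tau z x.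
Proof. by apply/val_inj/(addrI 1); rewrite !one_plus_tau mulrC. Qed.

Lemma tauM x y z : tau (tau x y) z = tau x (tau y z).
Proof. by apply/val_inj/(addrI 1); rewrite !one_plus_tau mulrA. Qed.

Lemma tauz0 x : tau x 0 = x.
Proof. by apply/val_inj/(addrI 1); rewrite one_plus_tau addr0 mul1r. Qed.

Lemma tau0z z : tau 0 z = z.
Proof. by rewrite tauC tauz0. Qed.

(** If u is the inverse of 1 + x, then u = 1 - u x, and u x has no constant
term. *)
Lemma tauV x : exists y, tau y x = 0.
Proof.
have [u ux] := one_plus_tfps_inv (tfps_valP x).
have yI : - (u * tfps_val x) \in @fpsX_ideal F.
  by rewrite rpredN fpsX_idealM // tfps_valP.
exists (TFps yI); apply/val_inj/(addrI 1); rewrite one_plus_tau /= addr0.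
have -> : 1 - u * x = u by rewrite -[X in X - _]ux mulrDr mulr1 addrK.
by rewrite mulrC.
Qed.

Lemma tau_affine x : affine_map (tau x).
Proof.
have tauB z : tau x z - tau x 0 = z + tfps_mul z x.
  by rewrite tauz0 /tau addrAC addrK.
apply/affine_map_linear => a u v; rewrite !tauB; apply: val_inj => /=.
by rewrite mulrDl -scalerAl scalerDr addrACA.
Qed.

Lemma fpsX_mul_eq0 f : fpsX F * f = 0 -> f = 0.
Proof.
move=> /fpsP Xf; apply/fpsP => n; have := Xf n.+1.
rewrite /= big_ord_recl big_ord_recl /= mul0r add0r mul1r subSS subn0.
by rewrite big1 ?addr0 // => i _; rewrite mul0r.
Qed.

(** Evaluate at z = t, which is not a zero divisor. *)
Lemma tau_translation_trivial x : (forall z, tau x z = z + x) -> x = 0.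
Proof.
have XI : fpsX F \in @fpsX_ideal F by rewrite mem_fpsX_ideal.
move=> /(_ (TFps XI)) Xx.
apply/val_inj/fpsX_mul_eq0/(addrI (fpsX F + tfps_val x)).
by rewrite addr0 -[LHS](tau_val x (TFps XI)) Xx.
Qed.

(** If n vectors spanned, their coefficients of index 1, ..., n + 1 would form
an n x (n + 1) matrix whose rows span all row vectors, as t, ..., t^(n + 1)
have the unit vectors as coefficients. *)
Lemma tfps_infinite_dimensional : ~ finite_dimensional (tfps F).
Proof.
case=> n [e eP]; pose M : 'M[F]_(n, n.+1) := \matrix_(i, j) fps_coef (e i) j.+1.
have coef_sum (c : 'I_n -> F) k :
    fps_coef (\sum_(i < n) c i *: e i : tfps F) k =
    \sum_(i < n) c i * fps_coef (e i) k.
  by apply: (big_morph (fun v : tfps F => fps_coef v k)).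
suff : (1%:M <= M)%MS by rewrite sub1mx -col_leq_rank leqNgt ltnS rank_leq_row.
apply/row_subP => j.
have tjI : Fps (fun k => (k == j.+1)%:R) \in @fpsX_ideal F.
  by rewrite mem_fpsX_ideal.
have [c tjE] := eP (TFps tjI).
apply/submxP; exists (\row_i c i); apply/rowP => k; rewrite !mxE.
have /(congr1 (fun v : tfps F => fps_coef v k.+1)) := tjE.
rewrite coef_sum /= eqSS eq_sym => ->.
by apply: eq_bigr => i _; rewrite !mxE.
Qed.
End PowerSeries.

Theorem corollary5 :
  (forall (F : fieldType) (V : lmodType F),
     finite_set [set: V] -> (exists v : V, v != 0) ->
     forall T : set (V -> V),
       perm_subgroup T (affine_group V) -> abelian_perm T -> regular_perm T ->
       translations V `&` T <> [set id])
  /\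
  (exists (F : fieldType) (V : lmodType F) (T : set (V -> V)),
     [/\ finite_set [set: V],
         perm_subgroup T (affine_group V),
         ~ abelian_perm T,
         regular_perm T &
         translations V `&` T = [set id]])
  /\
  (forall F : fieldType,
     ~ finite_dimensional (tfps F) /\
     [/\ perm_subgroup (range (@tau F)) (affine_group (tfps F)),
         abelian_perm (range (@tau F)),
         regular_perm (range (@tau F)) &
         translations (tfps F) `&` range (@tau F) = [set id]]).
Proof.
split=> [F V finV V0 T Taff Tab Treg /seteqP[NT1 _] |].
  have [y y0 Ty] := abelian_regular_translation Taff Tab Treg finV V0.
  have /funeqP/(_ 0) := NT1 (translation y) (conj (imageT _ y) Ty).
  by rewrite /translation /= add0r => /eqP; rewrite (negPf y0).
split=> [|F]; first exact: hegedus_example.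
split; first exact: tfps_infinite_dimensional.
split.
- exact: left_translations_affine
    (@tau0z F) (@tauz0 F) (@tauM F) (@tauV F) (@tau_affine F).
- move=> _ _ [x _ <-] [y _ <-]; apply/funext => z /=.
  by rewrite -!tauM (tauC x).
- exact: left_translations_regular
    (@tau0z F) (@tauz0 F) (@tauM F) (@tauV F).
- exact: translations_left_translations
    (@tau0z F) (@tauz0 F) (@tau_translation_trivial F).
Qed.
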